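(* Suppose that $f:\mathbb R^d\to\mathbb R$ satisfies $\underline f\le f(x)\le\overline f$ for all $x\in\mathbb R^d$ (finite constants $\underline f,\overline f$) and is globally Lipschitz with constant $L_f$. Then for all $\mu,\nu\in\mathcal P_2(\mathbb R^d)$, $$\bigl|\mathcal M_\alpha(\mu)-\mathcal M(\mu)-\mathcal M_\alpha(\nu)+\mathcal M(\nu)\bigr|\le C_{\mathcal M}\Bigl(\sqrt{\mathfrak M_2(\mu)}+\sqrt{\mathfrak M_2(\nu)}\Bigr)\mathcal W_2(\mu,\nu),\qquad C_{\mathcal M}:=2\alpha L_fe^{2\alpha(\overline f-\underline f)}.$$
   Context: Here $\alpha>0$, $|\cdot|$ is the Euclidean norm, $\mathcal P_2(\mathbb R^d)$ is the set of probability measures on $\mathbb R^d$ with finite second moment, $\mathcal W_2$ is the Wasserstein-2 distance. For $\mu$ with finite first moment, $\mathcal M(\mu):=\int x\,\mu(dx)$, $\mathcal M_\alpha(\mu):=\frac{\int x\,e^{-\alpha f(x)}\mu(dx)}{\int e^{-\alpha f(x)}\mu(dx)}$, and $\mathfrak M_2(\mu):=\int|x-\mathcal M(\mu)|^2\mu(dx)$. *)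

(* Defs.v *)
From HB Require Import structures.
From mathcomp Require Import all_boot all_order all_algebra.
From mathcomp Require Import all_classical all_reals all_analysis.
Import Order.TTheory GRing.Theory Num.Theory.
Import numFieldNormedType.Exports.

Set Implicit Arguments.
Unset Strict Implicit.
Unset Printing Implicit Defensive.

Local Open Scope classical_set_scope.
Local Open Scope ring_scope.

(* 'rV[R]_d with the Borel sigma-algebra of its usual topology. *)
Definition Rd (R : realType) (d : nat) : Type :=
  g_sigma_algebraType (@open 'rV[R]_d).

(* The library's norm on 'rV[R]_d is the sup norm, hence this definition. *)
Definition enorm (R : realType) (d : nat) (x : 'rV[R]_d) : R :=
  Num.sqrt (\sum_(i < d) x ord0 i ^+ 2).

Definition finite_second_moment (R : realType) (d : nat)
    (mu : probability (Rd R d) R) : Prop :=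
  (\int[mu]_x (enorm x ^+ 2)%:E < +oo)%E.

(* Vector-valued integrals are taken coordinatewise. *)
Definition mean (R : realType) (d : nat) (mu : probability (Rd R d) R)
    : 'rV[R]_d :=
  \row_(i < d) \int[mu]_(x in [set: Rd R d]) (x : 'rV[R]_d) ord0 i.

Definition weighted_mean (R : realType) (d : nat) (alpha : R)
    (f : 'rV[R]_d -> R) (mu : probability (Rd R d) R) : 'rV[R]_d :=
  (\int[mu]_(x in [set: Rd R d]) expR (- alpha * f x))^-1 *:
  \row_(i < d) \int[mu]_(x in [set: Rd R d])
                 ((x : 'rV[R]_d) ord0 i * expR (- alpha * f x)).

Definition centered_second_moment (R : realType) (d : nat)
    (mu : probability (Rd R d) R) : \bar R :=
  (\int[mu]_x (enorm ((x : 'rV[R]_d) - mean mu) ^+ 2)%:E)%E.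

Definition coupling (R : realType) (d : nat) (mu nu : probability (Rd R d) R)
    (P : probability (Rd R d * Rd R d)%type R) : Prop :=
  (forall A : set (Rd R d), measurable A -> pushforward P fst A = mu A) /\
  (forall B : set (Rd R d), measurable B -> pushforward P snd B = nu B).

Definition wasserstein2 (R : realType) (d : nat)
    (mu nu : probability (Rd R d) R) : \bar R :=
  sqrte (ereal_inf
    [set (\int[P]_z (enorm ((z.1 : 'rV[R]_d) - (z.2 : 'rV[R]_d)) ^+ 2)%:E)%E
      | P in [set P : probability (Rd R d * Rd R d)%type R |
               coupling mu nu P]]).

(* Main.v *)
(* Let w = exp(- alpha f) and let (X, Y) be a coupling of mu and nu with means
   m and n. The vector to be bounded is
     D = E[(X - m) w(X)] / E[w(X)] - E[(Y - n) w(Y)] / E[w(Y)].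
   Since X - m and Y - n are centered, each difference of weights that remains
   after regrouping is multiplied by a centered variable, so that
   Cauchy-Schwarz and the Lipschitz bound on w give a product of a standard
   deviation and of the L2 norm of X - Y. Vectors are reduced to scalars by
   pairing with D itself. The bound holds for every coupling, and the infimum
   over couplings is the Wasserstein distance. *)
Require Import Defs.
From HB Require Import structures.
From mathcomp Require Import all_boot all_order all_algebra.
From mathcomp Require Import all_classical all_reals all_analysis.
From mathcomp Require Import measurable_realfun ring lra.
Import Order.TTheory GRing.Theory Num.Theory.
Import numFieldNormedType.Exports.

Set Implicit Arguments.
Unset Strict Implicit.
Unset Printing Implicit Defensive.

Local Open Scope classical_set_scope.
Local Open Scope ring_scope.

(** * Euclidean norm and the Cauchy-Schwarz inequality *)

(** A quadratic that is nonnegative everywhere has nonpositive discriminant. This is the common core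
    of the Cauchy-Schwarz inequalities for finite sums and for integrals. *)
Lemma sqr_le_of_quadratic_ge0 (R : realFieldType) (a b h : R) :
  0 <= a -> (forall t, 0 <= t ^+ 2 * a - t * (2 * h) + b) -> h ^+ 2 <= a * b.
Proof.
rewrite le_eqVlt => /predU1P[<-|a0] quad.
  have [->|h0] := eqVneq h 0; first by rewrite expr2 !mul0r.
  (* With [a = 0] the quadratic is affine in [t]; at this point it would take the value -1. *)
  have := quad ((b + 1) / (2 * h)).
  by rewrite mulr0 divfK ?mulf_neq0//; lra.
(* [h / a] is the minimiser of the quadratic. *)
have := quad (h / a).
have -> : (h / a) ^+ 2 * a - h / a * (2 * h) + b = (a * b - h ^+ 2) / a.
  by field; rewrite gt_eqF.
by rewrite pmulr_lge0 ?invr_gt0// subr_ge0.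
Qed.

Section euclidean_norm.
Context {R : realType} {d : nat}.
Implicit Types x v : 'rV[R]_d.

Definition dot v x : R := \sum_(i < d) v ord0 i * x ord0 i.

Lemma enorm_ge0 x : 0 <= enorm x.
Proof. exact: sqrtr_ge0. Qed.

Lemma sqr_enorm x : enorm x ^+ 2 = \sum_(i < d) x ord0 i ^+ 2.
Proof. by rewrite sqr_sqrtr// sumr_ge0// => i _; exact: sqr_ge0. Qed.

Lemma enormE x : enorm x ^+ 2 = dot x x.
Proof. by rewrite sqr_enorm; apply: eq_bigr => i _; rewrite expr2. Qed.

Lemma le_coord_enorm x i : `|x ord0 i| <= enorm x.
Proof.
rewrite -(@ler_pXn2r _ 2) ?nnegrE ?enorm_ge0// real_normK ?num_real//.
rewrite sqr_enorm (bigD1 i)//= lerDl sumr_ge0// => j _; exact: sqr_ge0.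
Qed.

(** Cauchy-Schwarz: the quadratic in [t] is the sum of the squares of [t * v_i - x_i]. *)
Lemma dot_le v x : `|dot v x| <= enorm v * enorm x.
Proof.
rewrite -(@ler_pXn2r _ 2) ?nnegrE ?mulr_ge0 ?enorm_ge0//.
rewrite real_normK ?num_real// exprMn.
apply: sqr_le_of_quadratic_ge0 => [|t]; first exact: sqr_ge0.
rewrite !sqr_enorm /dot !mulr_sumr -sumrB -big_split/=.
apply: sumr_ge0 => i _.
have -> : t ^+ 2 * v ord0 i ^+ 2 - t * (2 * (v ord0 i * x ord0 i))
    + x ord0 i ^+ 2 = (t * v ord0 i - x ord0 i) ^+ 2 by ring.
exact: sqr_ge0.
Qed.

Lemma dotBr v x y : dot v (x - y) = dot v x - dot v y.
Proof. by rewrite /dot -sumrB; apply: eq_bigr => i _; rewrite !mxE mulrBr. Qed.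

End euclidean_norm.

(** * Square-integrable random variables and their L2 norm *)

Section square_integrable.
Context {d0 : measure_display} {T : measurableType d0} {R : realType}
  (P : probability T R).
Implicit Types a b f g h : T -> R.

Notation "'E[ h ]" := (Rintegral P setT h) (format "''E[' h ]").
Notation intP h := (P.-integrable setT (EFin \o h)).

Lemma Rintegral_probability_cst c : 'E[fun=> c] = c.
Proof.
rewrite Rintegral_cst// (_ : fine _ = 1) ?mulr1//.
by have := probability_setT P => /= ->.
Qed.

(** Measurability of [f] is recorded separately, since it does not follow from that of its
    square. *)
Definition sq_integrable f :=
  measurable_fun setT f /\ intP (fun t => f t ^+ 2).

(** The L2 norm as a real number. It is meaningful for square-integrable [f]: an infinite integral
    would be sent to 0 by [fine]. *)
Definition norm2 f : R := Num.sqrt 'E[fun t => f t ^+ 2].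

Lemma norm2_ge0 f : 0 <= norm2 f.
Proof. exact: sqrtr_ge0. Qed.

Lemma sqr_norm2 f : norm2 f ^+ 2 = 'E[fun t => f t ^+ 2].
Proof. by rewrite sqr_sqrtr// Rintegral_ge0// => t _; exact: sqr_ge0. Qed.

Lemma norm2_cst1 : norm2 (cst 1) = 1.
Proof.
rewrite /norm2 (_ : (fun _ => _) = cst 1); last first.
  by apply/funext => t /=; rewrite expr1n.
by rewrite Rintegral_probability_cst sqrtr1.
Qed.

Lemma le_Rintegrable h g : measurable_fun setT h -> intP g ->
  (forall t, `|h t| <= g t) -> intP h.
Proof.
move=> mh ig hg; apply: le_integrable ig => //.
  exact/measurable_EFinP.
by move=> t _ /=; rewrite lee_fin (le_trans (hg t))// ler_norm.
Qed.

Lemma integrable_cst c : intP (fun=> c).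
Proof. exact: finite_measure_integrable_cst. Qed.

Lemma integrableDR f g : intP f -> intP g -> intP (fun t => f t + g t).
Proof.
move=> If Ig; have := integrableD measurableT If Ig.
by apply: eq_integrable => // t _ /=.
Qed.

Lemma integrableBR f g : intP f -> intP g -> intP (fun t => f t - g t).
Proof.
move=> If Ig; have := integrableB measurableT If Ig.
by apply: eq_integrable => // t _ /=.
Qed.

Lemma integrableZR c f : intP f -> intP (fun t => c * f t).
Proof.
move=> If; have := integrableZl measurableT c If.
by apply: eq_integrable => // t _ /=.
Qed.

Lemma Rintegral_sum I (r : seq I) (h : I -> T -> R) : (forall i, intP (h i)) ->
  intP (fun t => \sum_(i <- r) h i t) /\
  'E[fun t => \sum_(i <- r) h i t] = \sum_(i <- r) 'E[h i].
Proof.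
move=> hi; elim: r => [|i r [ir Er]].
  split; first by under eq_fun do rewrite big_nil; exact: integrable_cst.
  under eq_Rintegral do rewrite big_nil.
  by rewrite big_nil Rintegral_probability_cst.
split.
  by under eq_fun do rewrite big_cons; exact: integrableDR.
under eq_Rintegral do rewrite big_cons.
by rewrite RintegralD// Er big_cons.
Qed.

Lemma sq_integrable_cst c : sq_integrable (fun=> c).
Proof. by split => //; exact: integrable_cst. Qed.

Lemma le_sq_integrable h f g : measurable_fun setT h ->
  sq_integrable f -> sq_integrable g ->
  (forall t, `|h t| <= `|f t| + `|g t|) -> sq_integrable h.
Proof.
move=> mh [mf sf] [mg sg] hfg; split => //.
(* The dominating function comes from [(y + z)^2 <= 2 y^2 + 2 z^2]. *)
apply: (@le_Rintegrable _ (fun t => 2 * f t ^+ 2 + 2 * g t ^+ 2)).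
- exact: measurable_funX.
- by apply: integrableDR; exact: integrableZR.
- move=> t; rewrite normrX; have := hfg t; have := normr_ge0 (h t).
  rewrite -(real_normK (num_real (f t))) -(real_normK (num_real (g t))).
  move: `|h t| `|f t| `|g t| => x y z x0 xyz.
  have := sqr_ge0 (y - z); have : x ^+ 2 <= (y + z) ^+ 2.
    by rewrite ler_pXn2r// nnegrE (le_trans x0).
  by rewrite sqrrD sqrrB; lra.
Qed.

Lemma sq_integrableB f g :
  sq_integrable f -> sq_integrable g -> sq_integrable (fun t => f t - g t).
Proof.
move=> sf sg; apply: (le_sq_integrable _ sf sg) => [|t].
  by apply: measurable_funB; [exact: sf.1 | exact: sg.1].
exact: ler_normB.
Qed.

(** Domination by [y z <= y^2 + z^2] for nonnegative [y], [z]. Allowing any [h] below the product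
    covers [f * g], [f] alone (with [g = 1]) and products of absolute values. *)
Lemma sq_integrableM h f g : measurable_fun setT h ->
  sq_integrable f -> sq_integrable g ->
  (forall t, `|h t| <= `|f t * g t|) -> intP h.
Proof.
move=> mh [mf sf] [mg sg] hfg.
apply: (@le_Rintegrable _ (fun t => f t ^+ 2 + g t ^+ 2)) => //.
  exact: integrableDR.
move=> t; apply: le_trans (hfg t) _; rewrite normrM.
rewrite -(real_normK (num_real (f t))) -(real_normK (num_real (g t))).
move: `|f t| `|g t| (normr_ge0 (f t)) (normr_ge0 (g t)) => y z y0 z0.
by have := sqr_ge0 (y - z); have := mulr_ge0 y0 z0; rewrite sqrrB; lra.
Qed.

Lemma sq_integrable_mul f g :
  sq_integrable f -> sq_integrable g -> intP (fun t => f t * g t).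
Proof.
move=> sf sg; apply: (sq_integrableM _ sf sg) => //.
by apply: measurable_funM; [exact: sf.1 | exact: sg.1].
Qed.

Lemma sq_integrableW f : sq_integrable f -> intP f.
Proof.
move=> sf; apply: (sq_integrableM _ sf (sq_integrable_cst 1)) => //.
  exact: sf.1.
by move=> t; rewrite mulr1.
Qed.

Lemma bounded_sq_integrable h c : measurable_fun setT h ->
  (forall t, `|h t| <= c) -> sq_integrable h.
Proof.
move=> mh hc.
apply: (le_sq_integrable mh (sq_integrable_cst c) (sq_integrable_cst 0)) => t.
by rewrite normr0 addr0 (le_trans (hc t))// ler_norm.
Qed.

(** Cauchy-Schwarz for integrals: the quadratic in [t] is the integral of [(t * |a| - |b|)^2]. The
    pointwise bound with a factor [k] is the form in which the Lipschitz estimates arrive. *)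
Lemma normr_Rintegral_le_norm2 k h a b : 0 <= k -> measurable_fun setT h ->
  sq_integrable a -> sq_integrable b ->
  (forall t, `|h t| <= k * (`|a t| * `|b t|)) ->
  `|'E[h]| <= k * (norm2 a * norm2 b).
Proof.
move=> k0 mh sa sb hab.
have iab : intP (fun t => `|a t| * `|b t|).
  apply: (sq_integrableM _ sa sb) => [|t].
    by apply: measurable_funM; apply: measurableT_comp => //;
      [exact: sa.1 | exact: sb.1].
  by rewrite -normrM normr_id.
have ih : intP h by apply: (le_Rintegrable mh (integrableZR k iab)).
apply: (le_trans (le_normr_Rintegral measurableT ih)).
apply: (@le_trans _ _ 'E[fun t => k * (`|a t| * `|b t|)]).
  by apply: le_Rintegral => //; [exact: integrable_norm|exact: integrableZR].
rewrite RintegralZl// ler_wpM2l// -(@ler_pXn2r _ 2)//; last 2 first.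
- by rewrite nnegrE Rintegral_ge0// => t _; exact: mulr_ge0.
- by rewrite nnegrE mulr_ge0// norm2_ge0.
rewrite exprMn; apply: sqr_le_of_quadratic_ge0 => [|t]; first exact: sqr_ge0.
rewrite !sqr_norm2 -!RintegralZl ?sa.2 ?sb.2//; last exact: integrableZR.
rewrite -RintegralB//; last 2 first.
- exact: integrableZR sa.2.
- exact/integrableZR/integrableZR.
rewrite -RintegralD//; last 2 first.
- by apply: integrableBR; [exact: integrableZR sa.2|exact/integrableZR/integrableZR].
- exact: sb.2.
apply: Rintegral_ge0 => x _.
rewrite -(real_normK (num_real (a x))) -(real_normK (num_real (b x))).
have -> : t ^+ 2 * `|a x| ^+ 2 - t * (2 * (`|a x| * `|b x|)) + `|b x| ^+ 2 =
  (t * `|a x| - `|b x|) ^+ 2 by ring.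
exact: sqr_ge0.
Qed.

(** The variance equals the second moment minus the squared mean. *)
Lemma Rintegral_sqr_center_le f : sq_integrable f ->
  'E[fun t => (f t - 'E[f]) ^+ 2] <= 'E[fun t => f t ^+ 2].
Proof.
move=> sf; set m := 'E[f].
have -> : 'E[fun t => (f t - m) ^+ 2] =
    'E[fun t => f t ^+ 2 - (2 * m) * f t + m ^+ 2].
  by apply: eq_Rintegral => t _; ring.
have if1 := sq_integrableW sf; have if2 := sf.2.
rewrite RintegralD//; last 2 first.
- by apply: integrableBR => //; exact: integrableZR.
- exact: integrable_cst.
rewrite RintegralB//; last exact: integrableZR.
rewrite RintegralZl// Rintegral_probability_cst -/m.
by have := sqr_ge0 m; rewrite expr2; lra.
Qed.

End square_integrable.

(** * Comparison of two weighted means on one probability space *)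

Section weighted_means.
Context {d0 : measure_display} {T : measurableType d0} {R : realType}
  (P : probability T R).

Notation "'E[ h ]" := (Rintegral P setT h) (format "''E[' h ]").
Notation "'N2[ h ]" := (norm2 P h) (format "''N2[' h ]").

Section scalar.
(** Intended reading, with [m] and [n] the means of [X] and [Y]: [A] and [B] are the pairings of [D]
    with [X - m] and [Y - n]; [p = w(X)], [q = w(Y)]; [N], [a], [b], [u] are the norms of [X - Y],
    [X - m], [Y - n] and [(X - m) - (Y - n)]; [V = |D|] and [c = w(n)]. *)
Variables (A B p q N a b u : T -> R) (lo hi K V c : R).
Hypotheses (lo0 : 0 < lo) (K0 : 0 <= K) (V0 : 0 <= V).
Hypotheses (mp : measurable_fun setT p) (mq : measurable_fun setT q).
Hypotheses (plohi : forall t, lo <= p t <= hi) (qlohi : forall t, lo <= q t <= hi).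
Hypotheses (sA : sq_integrable P A) (sB : sq_integrable P B)
  (sN : sq_integrable P N) (sa : sq_integrable P a)
  (sb : sq_integrable P b) (su : sq_integrable P u).
Hypotheses (EA : 'E[A] = 0) (EB : 'E[B] = 0).
Hypotheses (Aa : forall t, `|A t| <= V * `|a t|)
  (ABu : forall t, `|A t - B t| <= V * `|u t|)
  (pqN : forall t, `|p t - q t| <= K * `|N t|)
  (qcb : forall t, `|q t - c| <= K * `|b t|).

Lemma sq_integrable_weight (r : T -> R) : measurable_fun setT r ->
  (forall t, lo <= r t <= hi) -> sq_integrable P r.
Proof.
move=> mr rlohi; apply: (@bounded_sq_integrable _ _ _ P _ hi) => // t.
by case/andP: (rlohi t) => lr rh; rewrite ger0_norm// (le_trans (ltW lo0)).
Qed.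

Lemma le_Rintegral_weight (r : T -> R) : measurable_fun setT r ->
  (forall t, lo <= r t <= hi) -> lo <= 'E[r].
Proof.
move=> mr rlohi; rewrite -(Rintegral_probability_cst P lo).
apply: le_Rintegral => //; first exact: integrable_cst.
  exact/sq_integrableW/sq_integrable_weight.
by move=> t _; case/andP: (rlohi t).
Qed.

(* E[Ap]/E[p] - E[Bq]/E[q] is split into E[A(p-q)]/E[p],
   E[Aq] (1/E[p] - 1/E[q]) and E[(A-B)q]/E[q]; in the last term q may be
   replaced by q - c since A - B is centered. *)
Lemma weighted_center_diff_le :
  `|'E[fun t => A t * p t] / 'E[p] - 'E[fun t => B t * q t] / 'E[q]| <=
  V * (K * ((lo^-1 + hi / lo ^+ 2) * 'N2[a] * 'N2[N]
            + lo^-1 * 'N2[u] * 'N2[b])).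
Proof.
have sp := sq_integrable_weight mp plohi.
have sq := sq_integrable_weight mq qlohi.
have ip := sq_integrableW sp; have iq := sq_integrableW sq.
have iA := sq_integrableW sA; have iB := sq_integrableW sB.
have iAp := sq_integrable_mul sA sp; have iAq := sq_integrable_mul sA sq.
have iBq := sq_integrable_mul sB sq.
have loZp := le_Rintegral_weight mp plohi.
have loZq := le_Rintegral_weight mq qlohi.
have Zp0 := lt_le_trans lo0 loZp; have Zq0 := lt_le_trans lo0 loZq.
have hige0 : 0 <= hi.
  rewrite (le_trans (ltW Zp0))// -[leRHS](Rintegral_probability_cst P).
  apply: le_Rintegral => //; first exact: integrable_cst.
  by move=> t _; case/andP: (plohi t).
have E1 : 'E[fun t => A t * (p t - q t)] =
    'E[fun t => A t * p t] - 'E[fun t => A t * q t].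
  by rewrite -RintegralB//; apply: eq_Rintegral => t _; rewrite mulrBr.
have E0 : 'E[fun t => p t - q t] = 'E[p] - 'E[q] by rewrite RintegralB.
have E3 : 'E[fun t => (A t - B t) * (q t - c)] =
    'E[fun t => A t * q t] - 'E[fun t => B t * q t].
  transitivity 'E[fun t => (A t * q t - B t * q t) - c * (A t - B t)].
    by apply: eq_Rintegral => t _; ring.
  have iAB : P.-integrable setT (EFin \o (fun t => A t - B t)).
    exact: integrableBR.
  rewrite RintegralB//; last 2 first.
  - exact: integrableBR.
  - exact: integrableZR.
  by rewrite RintegralB// RintegralZl// RintegralB// EA EB subrr mulr0 subr0.
have mA := sA.1; have mB := sB.1.
have le1 : `|'E[fun t => A t * (p t - q t)]| <= V * K * ('N2[a] * 'N2[N]).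
  apply: normr_Rintegral_le_norm2 => //; first exact: mulr_ge0.
    by apply: measurable_funM => //; exact: measurable_funB.
  by move=> t; rewrite normrM mulrACA ler_pM.
(* Here and in [le0] the second factor of Cauchy-Schwarz is the constant 1, whose L2 norm is 1. *)
have le2 : `|'E[fun t => A t * q t]| <= V * hi * ('N2[a] * 1).
  rewrite -(norm2_cst1 P); apply: normr_Rintegral_le_norm2 => //.
  - exact: mulr_ge0.
  - exact: measurable_funM.
  - exact: sq_integrable_cst.
  move=> t; rewrite normrM normr1 mulrACA mulr1 ler_pM//.
  by case/andP: (qlohi t) => lq qh; rewrite ger0_norm// (le_trans (ltW lo0)).
have le0 : `|'E[fun t => p t - q t]| <= K * ('N2[N] * 1).
  rewrite -(norm2_cst1 P); apply: normr_Rintegral_le_norm2 => //.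
  - exact: measurable_funB.
  - exact: sq_integrable_cst.
  by move=> t; rewrite /= normr1 mulr1.
have le3 : `|'E[fun t => (A t - B t) * (q t - c)]| <=
    V * K * ('N2[u] * 'N2[b]).
  apply: normr_Rintegral_le_norm2 => //; first exact: mulr_ge0.
    by apply: measurable_funM; apply: measurable_funB.
  by move=> t; rewrite normrM mulrACA ler_pM.
have -> : 'E[fun t => A t * p t] / 'E[p] - 'E[fun t => B t * q t] / 'E[q] =
    'E[fun t => A t * (p t - q t)] / 'E[p]
    - 'E[fun t => A t * q t] * 'E[fun t => p t - q t] * ('E[p]^-1 * 'E[q]^-1)
    + 'E[fun t => (A t - B t) * (q t - c)] / 'E[q].
  by rewrite E1 E0 E3; field; rewrite !gt_eqF.
have iZp : 'E[p]^-1 <= lo^-1 by rewrite lef_pV2.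
have iZq : 'E[q]^-1 <= lo^-1 by rewrite lef_pV2.
have iZp0 : 0 <= 'E[p]^-1 by rewrite invr_ge0 ltW.
have iZq0 : 0 <= 'E[q]^-1 by rewrite invr_ge0 ltW.
apply: le_trans (ler_normD _ _) _.
(* The bound is split to match the three terms. The middle one takes [hi] from [q] and [lo^-1] from
   each of the two denominators. *)
have -> : V * (K * ((lo^-1 + hi / lo ^+ 2) * 'N2[a] * 'N2[N]
            + lo^-1 * 'N2[u] * 'N2[b])) =
    (V * K * ('N2[a] * 'N2[N]) / lo
     + V * hi * ('N2[a] * 1) * (K * ('N2[N] * 1)) * (lo^-1 * lo^-1))
    + V * K * ('N2[u] * 'N2[b]) / lo.
  by rewrite expr2 invfM; ring.
apply: lerD; last by rewrite normrM ler_pM// ger0_norm.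
apply: le_trans (ler_normB _ _) _.
apply: lerD; first by rewrite normrM ler_pM// ger0_norm.
rewrite !normrM; apply: ler_pM; rewrite ?mulr_ge0//.
  exact: ler_pM.
by rewrite !ger0_norm// ler_pM.
Qed.

End scalar.

(** * From scalars to random vectors *)

Section vector.
Context {d : nat}.
Implicit Types X Y : T -> 'rV[R]_d.

Definition sq_integrable_vec X :=
  forall i, sq_integrable P (fun t => X t ord0 i).

Definition Evec X : 'rV[R]_d := \row_(i < d) 'E[fun t => X t ord0 i].

Lemma measurable_enorm_sqr X : sq_integrable_vec X ->
  measurable_fun setT (fun t => enorm (X t) ^+ 2).
Proof.
move=> sX; rewrite (_ : (fun _ => _) = fun t => \sum_(i < d) X t ord0 i ^+ 2).
  by apply: measurable_sum => i; apply: measurable_funX; exact: (sX i).1.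
by apply/funext => t; rewrite sqr_enorm.
Qed.

Lemma sq_integrable_enorm X : sq_integrable_vec X ->
  sq_integrable P (fun t => enorm (X t)).
Proof.
move=> sX; split.
  rewrite (_ : (fun _ => _) = Num.sqrt \o (fun t => enorm (X t) ^+ 2)).
    apply: measurableT_comp (measurable_enorm_sqr sX).
    by apply: continuous_measurable_fun; exact: sqrt_continuous.
  by apply/funext => t /=; rewrite sqrtr_sqr ger0_norm// enorm_ge0.
under [X in EFin \o X]eq_fun do rewrite sqr_enorm.
by apply: (Rintegral_sum _ _).1 => i; exact: (sX i).2.
Qed.

Lemma Rintegral_sqr_enorm X : sq_integrable_vec X ->
  'E[fun t => enorm (X t) ^+ 2] = \sum_(i < d) 'E[fun t => X t ord0 i ^+ 2].
Proof.
move=> sX; under eq_Rintegral do rewrite sqr_enorm.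
by rewrite (Rintegral_sum _ _).2// => i; exact: (sX i).2.
Qed.

Lemma sq_integrable_vecB X Y : sq_integrable_vec X -> sq_integrable_vec Y ->
  sq_integrable_vec (fun t => X t - Y t).
Proof.
move=> sX sY i; under eq_fun do rewrite !mxE.
exact: sq_integrableB.
Qed.

Lemma sq_integrable_vec_center X m : sq_integrable_vec X ->
  sq_integrable_vec (fun t => X t - m).
Proof.
by move=> sX; apply: sq_integrable_vecB => // i; exact: sq_integrable_cst.
Qed.

(** In each coordinate the left side is the centered version of [X - Y], so this is the bound of a
    variance by a second moment, summed over coordinates. *)
Lemma norm2_center_diff_le X Y : sq_integrable_vec X -> sq_integrable_vec Y ->
  norm2 P (fun t => enorm (X t - Evec X - (Y t - Evec Y))) <=
  norm2 P (fun t => enorm (X t - Y t)).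
Proof.
move=> sX sY; apply: ler_wsqrtr.
have sXc := sq_integrable_vec_center (Evec X) sX.
have sYc := sq_integrable_vec_center (Evec Y) sY.
rewrite (Rintegral_sqr_enorm (sq_integrable_vecB sXc sYc)).
rewrite (Rintegral_sqr_enorm (sq_integrable_vecB sX sY)).
apply: ler_sum => i _.
have sXY : sq_integrable P (fun t => X t ord0 i - Y t ord0 i).
  exact: sq_integrableB.
under [leRHS]eq_Rintegral do rewrite !mxE.
apply: le_trans (Rintegral_sqr_center_le sXY).
rewrite RintegralB//; [|exact: sq_integrableW..].
rewrite le_eqVlt; apply/orP; left; apply/eqP; apply: eq_Rintegral => t _.
by rewrite !mxE; ring.
Qed.

Lemma sq_integrable_dot v X : sq_integrable_vec X ->
  sq_integrable P (fun t => dot v (X t)).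
Proof.
move=> sX; have [mX iX] := sq_integrable_enorm sX.
have mdot : measurable_fun setT (fun t => dot v (X t)).
  by apply: measurable_sum => i; apply: measurable_funM => //; exact: (sX i).1.
split => //; apply: (le_Rintegrable _ (integrableZR (enorm v ^+ 2) iX)).
  exact: measurable_funX.
move=> t; rewrite normrX -exprMn ler_pXn2r ?nnegrE ?mulr_ge0 ?enorm_ge0//.
exact: dot_le.
Qed.

Variables (w : 'rV[R]_d -> R) (lo hi K : R).
Hypotheses (lo0 : 0 < lo) (K0 : 0 <= K).
Hypothesis wlohi : forall x, lo <= w x <= hi.
Hypothesis wlip : forall x y, `|w x - w y| <= K * enorm (x - y).

(** The [w]-weighted mean of a random vector. For the identity on [Rd R d] and [w = exp(- alpha f)]
    it unfolds to [weighted_mean]. *)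
Definition wvec X : 'rV[R]_d :=
  'E[w \o X]^-1 *: \row_(i < d) 'E[fun t => X t ord0 i * w (X t)].

(** A constant is its own weighted mean, since the normalisation is at least [lo > 0]. Hence the
    mean can be subtracted under the weighted integral, and linearity brings the pairing inside. *)
Lemma dot_wvec_center v X : sq_integrable_vec X -> measurable_fun setT (w \o X) ->
  dot v (wvec X - Evec X) =
  'E[fun t => dot v (X t - Evec X) * w (X t)] / 'E[w \o X].
Proof.
move=> sX mw; set Z := 'E[w \o X].
have sw : sq_integrable P (w \o X).
  by apply: (sq_integrable_weight lo0 mw) => t; exact: wlohi.
have Z0 : Z != 0.
  rewrite gt_eqF// (lt_le_trans lo0)//.
  by apply: (le_Rintegral_weight lo0 mw) => t; exact: wlohi.
have iXw i : P.-integrable setT (EFin \o (fun t => X t ord0 i * w (X t))).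
  exact: sq_integrable_mul (sX i) sw.
have iw c : P.-integrable setT (EFin \o (fun t => c * w (X t))).
  exact/integrableZR/(sq_integrableW sw).
have i1 i : P.-integrable setT
    (EFin \o (fun t => X t ord0 i * w (X t) - Evec X ord0 i * w (X t))).
  exact: integrableBR.
have -> : 'E[fun t => dot v (X t - Evec X) * w (X t)] =
  'E[fun t => \sum_(i < d) v ord0 i *
      (X t ord0 i * w (X t) - Evec X ord0 i * w (X t))].
  apply: eq_Rintegral => t _; rewrite /dot mulr_suml.
  by apply: eq_bigr => i _; rewrite !mxE; ring.
rewrite (Rintegral_sum _ _).2; last by move=> i; exact: integrableZR.
rewrite mulr_suml; apply: eq_bigr => i _.
rewrite RintegralZl// RintegralB// RintegralZl//; last exact: sq_integrableW.
by rewrite /wvec !mxE -/Z; field.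
Qed.

Lemma Rintegral_dot_center v X : sq_integrable_vec X ->
  'E[fun t => dot v (X t - Evec X)] = 0.
Proof.
move=> sX; have iX i := sq_integrableW (sX i).
have ic i : P.-integrable setT (EFin \o (fun t => X t ord0 i - Evec X ord0 i)).
  by apply: integrableBR => //; exact: integrable_cst.
have -> : 'E[fun t => dot v (X t - Evec X)] =
    'E[fun t => \sum_(i < d) v ord0 i * (X t ord0 i - Evec X ord0 i)].
  by apply: eq_Rintegral => t _; apply: eq_bigr => i _; rewrite !mxE.
rewrite (Rintegral_sum _ _).2; last by move=> i; exact: integrableZR.
rewrite big1// => i _; rewrite RintegralZl// RintegralB//; last exact: integrable_cst.
by rewrite Rintegral_probability_cst mxE subrr mulr0.
Qed.

Lemma enorm_wvec_diff_le X Y : sq_integrable_vec X -> sq_integrable_vec Y ->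
  measurable_fun setT (w \o X) -> measurable_fun setT (w \o Y) ->
  enorm (wvec X - Evec X - wvec Y + Evec Y) <=
  K * ((lo^-1 + hi / lo ^+ 2) * 'N2[fun t => enorm (X t - Evec X)]
       + lo^-1 * 'N2[fun t => enorm (Y t - Evec Y)])
    * 'N2[fun t => enorm (X t - Y t)].
Proof.
move=> sX sY mwX mwY.
have -> : wvec X - Evec X - wvec Y + Evec Y =
    (wvec X - Evec X) - (wvec Y - Evec Y) by rewrite opprB addrA addrAC.
set D := _ - _ - _.
(* The scalar estimate bounds [|D|^2] by [|D|] times the target, so [|D| = 0] is set apart before
   cancelling. *)
have [->|D0] := eqVneq (enorm D) 0.
  have lo0' : 0 <= lo^-1 by rewrite invr_ge0 ltW.
  have hi0 : 0 <= hi by case/andP: (wlohi 0) => /(lt_le_trans lo0)/ltW/le_trans; exact.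
  rewrite !(mulr_ge0, addr_ge0) ?norm2_ge0 ?invr_ge0 ?exprn_ge0// ltW//.
have Dgt0 : 0 < enorm D by rewrite lt_def D0 enorm_ge0.
have sXc := sq_integrable_vec_center (Evec X) sX.
have sYc := sq_integrable_vec_center (Evec Y) sY.
(* In [dot D D] only the second copy is expanded; the first stays as the fixed direction of the
   pairing. *)
rewrite -(ler_pM2l Dgt0) -expr2 enormE {2}/D dotBr !dot_wvec_center//.
apply: le_trans (ler_norm _) _.
apply: le_trans.
  (* The choice [c = w (Evec Y)] makes [|q - c|] at most [K] times the distance of [Y] to its mean,
     whence the standard deviation of [Y]. *)
  apply: (@weighted_center_diff_le
    (fun t => dot D (X t - Evec X)) (fun t => dot D (Y t - Evec Y))
    (w \o X) (w \o Y) (fun t => enorm (X t - Y t))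
    (fun t => enorm (X t - Evec X)) (fun t => enorm (Y t - Evec Y))
    (fun t => enorm (X t - Evec X - (Y t - Evec Y))) lo hi K (enorm D)
    (w (Evec Y))) => //.
  - exact: enorm_ge0.
  - by move=> t; exact: wlohi.
  - by move=> t; exact: wlohi.
  - exact: sq_integrable_dot.
  - exact: sq_integrable_dot.
  - exact/sq_integrable_enorm/sq_integrable_vecB.
  - exact: sq_integrable_enorm.
  - exact: sq_integrable_enorm.
  - exact/sq_integrable_enorm/sq_integrable_vecB.
  - exact: Rintegral_dot_center.
  - exact: Rintegral_dot_center.
  - by move=> t; rewrite (ger0_norm (enorm_ge0 _)) dot_le.
  - by move=> t; rewrite (ger0_norm (enorm_ge0 _)) -dotBr dot_le.
  - by move=> t; rewrite (ger0_norm (enorm_ge0 _)); exact: wlip.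
  - by move=> t; rewrite (ger0_norm (enorm_ge0 _)); exact: wlip.
(* What remains is to replace the norm of the centered difference by that of [X - Y]. *)
rewrite ler_pM2l// -[leRHS]mulrA ler_wpM2l// [leRHS]mulrDl lerD2l.
rewrite -[leLHS]mulrA -[leRHS]mulrA; apply: ler_wpM2l.
  by rewrite invr_ge0 ltW.
rewrite [leLHS]mulrC; apply: ler_wpM2l; first exact: norm2_ge0.
exact: norm2_center_diff_le.
Qed.

End vector.
End weighted_means.

(** * Transport of integrals from the coupling to its marginals *)

Section law.
Context {d1 d2 : measure_display} {T1 : measurableType d1}
  {T2 : measurableType d2} {R : realType}.
Variables (P : probability T1 R) (nu : probability T2 R) (phi : T1 -> T2).
Hypothesis mphi : measurable_fun setT phi.
Hypothesis law : forall A, measurable A -> pushforward P phi A = nu A.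

Lemma ge0_integral_law (g : T2 -> \bar R) : measurable_fun setT g ->
  (forall y, 0 <= g y)%E -> (\int[nu]_y g y = \int[P]_x g (phi x))%E.
Proof.
move=> mg g0.
have := ge0_integral_pushforward mphi P measurableT mg (fun y _ => g0 y).
rewrite preimage_setT => <-.
by apply: eq_measure_integral => A mA _; exact/esym/law.
Qed.

(** Positive and negative parts reduce this to the nonnegative case; the two extended integrals
    already agree before [fine] is applied. *)
Lemma Rintegral_law (g : T2 -> R) : measurable_fun setT g ->
  \int[nu]_y g y = \int[P]_x g (phi x).
Proof.
move=> /measurable_EFinP mg; congr fine; rewrite integralE [RHS]integralE.
rewrite (ge0_integral_law (measurable_funepos mg))//.
rewrite (ge0_integral_law (measurable_funeneg mg))//.
by congr (_ - _)%E; apply: eq_integral => x _; rewrite ?funeposE ?funenegE.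
Qed.

Lemma sq_integrable_law (g : T2 -> R) :
  sq_integrable nu g -> sq_integrable P (g \o phi).
Proof.
move=> [mg /integrableP[mg2 ig]].
have mgphi : measurable_fun setT (g \o phi) by exact: measurableT_comp.
split => //; apply/integrableP; split.
  by apply/measurable_EFinP; exact: measurable_funX.
have mag : measurable_fun setT (fun y => `|(g y ^+ 2)%:E|%E).
  exact: measurableT_comp.
by rewrite -(ge0_integral_law mag).
Qed.

Lemma norm2_law (g : T2 -> R) :
  measurable_fun setT g -> norm2 P (g \o phi) = norm2 nu g.
Proof.
by move=> mg; rewrite /norm2 (Rintegral_law (measurable_funX 2 mg)).
Qed.

Section vector.
Context {d : nat}.
Variables (X : T2 -> 'rV[R]_d) (w : 'rV[R]_d -> R).
Hypothesis mX : forall i, measurable_fun setT (fun t => X t ord0 i).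
Hypothesis mw : measurable_fun setT (w \o X).

Lemma Evec_law : Evec P (X \o phi) = Evec nu X.
Proof. by apply/rowP => i; rewrite !mxE (Rintegral_law (mX i)). Qed.

Lemma wvec_law : wvec P w (X \o phi) = wvec nu w X.
Proof.
rewrite /wvec (Rintegral_law mw); congr (_ *: _).
by apply/rowP => i; rewrite !mxE (Rintegral_law (measurable_funM (mX i) mw)).
Qed.

End vector.
End law.

(** * Borel measurability and continuity for the Euclidean norm *)

Section euclidean_borel.
Context {R : realType} {d : nat}.

(** Open intervals generate the Borel sets of [R], and their preimages are open, hence among the
    generators of [Rd R d]. *)
Lemma continuous_measurable_Rd (f : 'rV[R]_d -> R) :
  continuous f -> measurable_fun [set: Rd R d] f.
Proof.
move=> /continuousP cf; apply: (measurability _ (RGenOpens.measurableE R)).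
move=> _ [_ [a [b ->] <-]]; rewrite setTI.
by apply: sub_sigma_algebra; apply: cf; exact: interval_open.
Qed.

Lemma measurable_coord i :
  measurable_fun [set: Rd R d] (fun x : Rd R d => (x : 'rV[R]_d) ord0 i).
Proof. by apply: continuous_measurable_Rd; exact: coord_continuous. Qed.

Lemma coord_le_norm (x : 'rV[R]_d) i : `|x ord0 i| <= `|x|.
Proof.
by rewrite [leRHS]/Num.norm/= mx_normrE; apply/bigmax_geP; right; exists (ord0, i).
Qed.

(** Comparison with the sup norm, which defines the topology. The crude factor [d] in place of its
    square root suffices for continuity. *)
Lemma enorm_le_norm (x : 'rV[R]_d) : enorm x <= d%:R * `|x|.
Proof.
rewrite -(@ler_pXn2r _ 2) ?nnegrE ?mulr_ge0 ?enorm_ge0//.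
rewrite sqr_enorm exprMn.
apply: (@le_trans _ _ (\sum_(i < d) `|x| ^+ 2)).
  apply: ler_sum => i _; rewrite -(real_normK (num_real (x ord0 i))).
  by rewrite ler_pXn2r ?nnegrE//; exact: coord_le_norm.
rewrite sumr_const card_ord -[leLHS]mulr_natl ler_wpM2r ?exprn_ge0//.
by rewrite -natrX ler_nat; case: (d) => // n; rewrite expnS leq_pmulr ?expn1.
Qed.

Lemma enorm_lipschitz_continuous (f : 'rV[R]_d -> R) (L : R) :
  (forall x y, `|f x - f y| <= L * enorm (x - y)) -> continuous f.
Proof.
(* The added 1 keeps [M] positive even if [L] or [d] is 0. *)
move=> lipf x A /nbhs_ballP[e /= e0 eA]; pose M := `|L| * d%:R + 1.
have M0 : 0 < M by rewrite ltr_wpDl ?mulr_ge0.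
apply/nbhs_ballP; exists (M^-1 * e) => /=; first by rewrite mulr_gt0 ?invr_gt0.
move=> y; rewrite mx_norm_ball /ball_/= => xy.
apply: eA; rewrite -ball_normE/=; apply: le_lt_trans (lipf x y) _.
apply: (@le_lt_trans _ _ (M * `|x - y|)).
  rewrite mulrDl mul1r -mulrA ler_wpDr//.
  apply: (@le_trans _ _ (`|L| * enorm (x - y))).
    by rewrite ler_wpM2r ?enorm_ge0// ler_norm.
  by rewrite ler_wpM2l// enorm_le_norm.
by rewrite -ltr_pdivlMl.
Qed.

End euclidean_borel.

(** * The exponential weight and the bound for a fixed coupling *)

(** For [t <= s], factor out [exp s] and use [1 - exp(t - s) <= s - t]. *)
Lemma expR_lipschitz (R : realType) (c s t : R) : s <= c -> t <= c ->
  `|expR s - expR t| <= expR c * `|s - t|.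
Proof.
wlog st : s t / t <= s => [wlg sc tc|sc tc].
  have [|/ltW ts] := leP t s; first by move=> /wlg; exact.
  by rewrite distrC [in leRHS]distrC wlg.
rewrite !ger0_norm ?subr_ge0 ?ler_expR//.
apply: (@le_trans _ _ (expR s * (s - t))); last first.
  by rewrite ler_wpM2r ?subr_ge0// ler_expR.
have -> : expR t = expR s * expR (t - s) by rewrite -expRD addrC subrK.
rewrite -{1}(mulr1 (expR s)) -mulrBr ler_wpM2l ?expR_ge0//.
by have := expR_ge1Dx (t - s); lra.
Qed.

Lemma sqrte_integral_sqr (d0 : measure_display) (T : measurableType d0)
    (R : realType) (P : probability T R) (g : T -> R) : sq_integrable P g ->
  sqrte (\int[P]_x (g x ^+ 2)%:E)%E = (norm2 P g)%:E.
Proof.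
move=> [_ ig]; rewrite /norm2 /Rintegral.
by rewrite -[X in sqrte X]fineK//; exact: integrable_fin_num ig.
Qed.

Section coupling_bound.
Context {R : realType} {d : nat}.
Variables (alpha : R) (f : 'rV[R]_d -> R) (flow fup Lf : R).
Hypotheses (alpha0 : 0 < alpha) (Lf0 : 0 <= Lf).
Hypothesis flohi : forall x, flow <= f x <= fup.
Hypothesis lipf : forall x y, `|f x - f y| <= Lf * enorm (x - y).

(** As [alpha > 0], the weight decreases in [f]: the upper bound of [f] gives [lo] and the lower
    bound gives [hi]. *)
Let w x := expR (- alpha * f x).
Let lo := expR (- alpha * fup).
Let hi := expR (- alpha * flow).

Let wlohi x : lo <= w x <= hi.
Proof.
by rewrite !ler_expR !ler_nM2l ?oppr_lt0// andbC.
Qed.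

Let wlip x y : `|w x - w y| <= alpha * Lf * hi * enorm (x - y).
Proof.
have wc z : - alpha * f z <= - alpha * flow.
  by rewrite ler_nM2l ?oppr_lt0//; case/andP: (flohi z).
apply: le_trans (expR_lipschitz (wc x) (wc y)) _.
rewrite -mulrBr normrM normrN (gtr0_norm alpha0) -/hi.
have -> : alpha * Lf * hi * enorm (x - y) = hi * (alpha * (Lf * enorm (x - y))).
  by ring.
by rewrite !ler_wpM2l// ?ltW ?expR_gt0.
Qed.

Let mw : measurable_fun [set: Rd R d] w.
Proof.
apply: measurableT_comp => //; apply: measurable_funM => //.
apply: continuous_measurable_Rd.
exact: enorm_lipschitz_continuous lipf.
Qed.

Variables mu nu : probability (Rd R d) R.

Lemma finite_second_moment_sq_integrable (m : probability (Rd R d) R) :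
  finite_second_moment m -> sq_integrable_vec m (id : Rd R d -> 'rV[R]_d).
Proof.
move=> m2 i; have mi := @measurable_coord R d i; split => //.
apply/integrableP; split; first by apply/measurable_EFinP; exact: measurable_funX.
apply: le_lt_trans m2; apply: ge0_le_integral => //.
- by apply: measurableT_comp => //; apply/measurable_EFinP; exact: measurable_funX.
- apply/measurable_EFinP.
  rewrite (_ : (fun _ => _) = fun x : Rd R d => \sum_(j < d) (x : 'rV[R]_d) ord0 j ^+ 2).
    by apply: measurable_sum => j; apply: measurable_funX; exact: measurable_coord.
  by apply/funext => x; rewrite sqr_enorm.
- move=> x _ /=; rewrite lee_fin normrX.
  by rewrite ler_pXn2r ?nnegrE ?enorm_ge0//; exact: le_coord_enorm.
Qed.

Lemma sqrte_centered_second_moment (m : probability (Rd R d) R) :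
  finite_second_moment m ->
  sqrte (centered_second_moment m) =
  (norm2 m (fun x : Rd R d => enorm ((x : 'rV[R]_d) - mean m)))%:E.
Proof.
move=> /finite_second_moment_sq_integrable sm; apply: sqrte_integral_sqr.
exact/sq_integrable_enorm/(sq_integrable_vec_center _ sm).
Qed.

Hypotheses (mu2 : finite_second_moment mu) (nu2 : finite_second_moment nu).
Variable P : probability (Rd R d * Rd R d)%type R.
Hypothesis coupP : coupling mu nu P.

Let sq_fst : sq_integrable_vec P (fst : _ -> 'rV[R]_d).
Proof.
move=> i.
exact: (sq_integrable_law measurable_fst coupP.1
  (finite_second_moment_sq_integrable mu2 i)).
Qed.

Let sq_snd : sq_integrable_vec P (snd : _ -> 'rV[R]_d).
Proof.
move=> i.
exact: (sq_integrable_law measurable_snd coupP.2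
  (finite_second_moment_sq_integrable nu2 i)).
Qed.

Let cost := norm2 P (fun z => enorm ((z.1 : 'rV[R]_d) - (z.2 : 'rV[R]_d))).

Lemma sqrte_coupling_cost :
  sqrte (\int[P]_z (enorm ((z.1 : 'rV[R]_d) - (z.2 : 'rV[R]_d)) ^+ 2)%:E)%E
  = cost%:E.
Proof.
apply: sqrte_integral_sqr.
exact/sq_integrable_enorm/(sq_integrable_vecB sq_fst sq_snd).
Qed.

Lemma weighted_mean_coupling_le :
  enorm (weighted_mean alpha f mu - mean mu - weighted_mean alpha f nu + mean nu)
  <= 2 * alpha * Lf * expR (2 * alpha * (fup - flow)) *
     (norm2 mu (fun x : Rd R d => enorm ((x : 'rV[R]_d) - mean mu)) +
      norm2 nu (fun x : Rd R d => enorm ((x : 'rV[R]_d) - mean nu))) * cost.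
Proof.
have lo0 : 0 < lo by exact: expR_gt0.
have hi0 : 0 < hi by exact: expR_gt0.
have K0 : 0 <= alpha * Lf * hi by rewrite !mulr_ge0// ltW.
have := enorm_wvec_diff_le lo0 K0 wlohi wlip sq_fst sq_snd
  (measurableT_comp mw measurable_fst) (measurableT_comp mw measurable_snd).
have mid := @measurable_coord R d.
(* Means, weighted means and standard deviations depend only on the marginals; [cost] alone still
   sees the coupling. *)
rewrite (wvec_law measurable_fst coupP.1 mid mw).
rewrite (wvec_law measurable_snd coupP.2 mid mw).
rewrite (Evec_law measurable_fst coupP.1 mid).
rewrite (Evec_law measurable_snd coupP.2 mid).
have menorm m (m2 : finite_second_moment m) :=
  (sq_integrable_enorm (sq_integrable_vec_center (mean m)
    (finite_second_moment_sq_integrable m2))).1.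
have /= -> := norm2_law measurable_fst coupP.1 (menorm _ mu2).
have /= -> := norm2_law measurable_snd coupP.2 (menorm _ nu2).
move=> /le_trans; apply; rewrite -/cost.
set sm := norm2 mu _; set sn := norm2 nu _.
have sm0 : 0 <= sm by exact: norm2_ge0.
have sn0 : 0 <= sn by exact: norm2_ge0.
(* [r = hi / lo >= 1]. The coefficients of [sm] and [sn] become [r + r^2] and [r], up to the factor
   [alpha * Lf]; both are at most [2 r^2], which is the stated constant. *)
rewrite ler_wpM2r ?norm2_ge0//; set r := expR (alpha * (fup - flow)).
have r1 : 1 <= r.
  rewrite -expR0 ler_expR mulr_ge0 ?(ltW alpha0)// subr_ge0.
  by case/andP: (flohi 0) => /le_trans; exact.
have hiE : hi = r * lo by rewrite -expRD; congr expR; ring.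
have -> : expR (2 * alpha * (fup - flow)) = r ^+ 2.
  by rewrite expr2 -expRD; congr expR; ring.
have -> : alpha * Lf * hi * ((lo^-1 + hi / lo ^+ 2) * sm + lo^-1 * sn) =
    alpha * Lf * (r * sm + r ^+ 2 * sm + r * sn).
  by rewrite hiE; field; rewrite gt_eqF.
have -> : 2 * alpha * Lf * r ^+ 2 * (sm + sn) =
    alpha * Lf * (r ^+ 2 * sm + r ^+ 2 * sm + (r ^+ 2 * sn + r ^+ 2 * sn)).
  by ring.
have rr : r <= r ^+ 2 by rewrite expr2 ler_peMr// (le_trans ler01).
apply: ler_wpM2l; first by rewrite mulr_ge0// ltW.
apply: lerD; first by rewrite lerD2r ler_wpM2r.
rewrite (le_trans (ler_wpM2r sn0 rr))// lerDl.
by rewrite mulr_ge0// sqr_ge0.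
Qed.

End coupling_bound.

(** * Passage to the infimum over couplings *)

(** Independence provides a coupling, so the infimum defining the distance runs over a nonempty
    set. *)
Lemma coupling_product (R : realType) (d : nat) (mu nu : probability (Rd R d) R) :
  coupling mu nu (mu \x nu)%E.
Proof.
split=> [A mA|B mB]; rewrite /pushforward.
- rewrite -setXT; apply: etrans (product_measure1E mu nu mA measurableT) _.
  by have /= -> := probability_setT nu; rewrite mule1.
- rewrite -setTX; apply: etrans (product_measure1E mu nu measurableT mB) _.
  by have /= -> := probability_setT mu; rewrite mul1e.
Qed.

(* The set of values is required to be nonempty because of the junk product
   0 * +oo = 0. *)
Lemma le_mule_sqrte_ereal_inf (R : realType) (S : set (\bar R)) (x k : R) :
  0 <= k -> S !=set0 -> (forall s, S s -> 0 <= s)%E ->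
  (forall s, S s -> x%:E <= k%:E * sqrte s)%E ->
  (x%:E <= k%:E * sqrte (ereal_inf S))%E.
Proof.
rewrite le_eqVlt => /predU1P[<-|k0] [s Ss] S0 xS.
  by have := xS _ Ss; rewrite !mul0e.
have [x0|x0] := leP x 0.
  apply: (@le_trans _ _ 0%E); first by rewrite lee_fin.
  by rewrite mule_ge0 ?sqrte_ge0 ?lee_fin ?ltW.
have xk0 : 0 <= x / k by rewrite divr_ge0// ltW.
suff : ((x / k)%:E <= sqrte (ereal_inf S))%E.
  by rewrite -(@lee_pmul2l _ k%:E)// -EFinM mulrC divfK ?gt_eqF.
(* Under the square root the claim says that [(x / k)^2] is a lower bound of [S], which monotonicity
   of [sqrte] gives element by element. *)
have -> : (x / k)%:E = sqrte ((x / k)%:E ^+ 2).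
  by rewrite sqrte_sqr gee0_abs// lee_fin.
rewrite lee_sqrt; last exact: le_ereal_inf_tmp.
apply: le_ereal_inf_tmp => t St; rewrite -lee_sqrt ?S0//.
rewrite sqrte_sqr gee0_abs ?lee_fin//.
by rewrite -(@lee_pmul2l _ k%:E)// -EFinM mulrC divfK ?gt_eqF ?xS.
Qed.

Theorem lemma5p13 (R : realType) (d : nat) (alpha : R) (f : 'rV[R]_d -> R)
    (flow fup Lf : R) :
  0 < alpha ->
  (forall x : 'rV[R]_d, flow <= f x <= fup) ->
  (forall x y : 'rV[R]_d, `|f x - f y| <= Lf * enorm (x - y)) ->
  forall mu nu : probability (Rd R d) R,
  finite_second_moment mu -> finite_second_moment nu ->
  ((enorm (weighted_mean alpha f mu - mean mu
           - weighted_mean alpha f nu + mean nu))%:E <=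
   (2 * alpha * Lf * expR (2 * alpha * (fup - flow)))%:E *
   (sqrte (centered_second_moment mu) + sqrte (centered_second_moment nu)) *
   wasserstein2 mu nu)%E.
Proof.
move=> alpha0 flohi lipf mu nu mu2 nu2.
have [Lf0|Lf0] := leP 0 Lf; last first.
  (* A negative Lipschitz constant is only possible in dimension 0. *)
  have enorm0 (x : 'rV[R]_d) : enorm x = 0.
    have := le_trans (normr_ge0 _) (lipf x 0).
    rewrite subr0 nmulr_rge0// => x0.
    by apply/eqP; rewrite eq_le x0 enorm_ge0.
  have csm0 (m : probability (Rd R d) R) : centered_second_moment m = 0%E.
    by apply: integral0_eq => x _; rewrite enorm0 expr0n.
  by rewrite !csm0 sqrte0 adde0 mule0 mul0e enorm0.
(* Finite second moments make the factor in front of the distance a real number, as the passage to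
   the infimum requires. *)
rewrite !sqrte_centered_second_moment// -EFinD -EFinM.
apply: le_mule_sqrte_ereal_inf.
- by rewrite !mulr_ge0 ?addr_ge0 ?norm2_ge0 ?expR_ge0// ltW.
- by eexists; exists (mu \x nu)%E => //; exact: coupling_product.
- by move=> _ [P _ <-]; apply: integral_ge0 => z _; rewrite lee_fin sqr_ge0.
- move=> _ [P coupP <-]; rewrite (sqrte_coupling_cost mu2 nu2 coupP) -EFinM.
  by rewrite lee_fin; exact: weighted_mean_coupling_le.
Qed.
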